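(* Let $P\subseteq M_{\mathbb{R}}$ be a smooth $d$-dimensional lattice polytope ($d\ge 1$) with $n$ vertices. Let $\gamma$ be the smallest integer such that $P\subseteq C_{v,\gamma}$ for every vertex $v$ of $P$. Then $P$ is $k$-normal for all \[k\ge (\gamma-1)\cdot (d-1)\cdot n+1.\]
   Context: $M$ is a lattice of rank $d$ and $M_{\mathbb{R}}=M\otimes\mathbb{R}$. A lattice polytope is the convex hull of finitely many points of $M$. A $d$-dimensional lattice polytope $P$ is smooth if at every vertex $v$ there are exactly $d$ edges $E_1,\dots,E_d$ of $P$ and the primitive lattice vectors along these edges starting from $v$ form a $\mathbb{Z}$-basis of $M$. Write these primitive vectors as $w_{E_1}-v,\dots,w_{E_d}-v$, where $w_{E_i}\in P\cap M$ is the first lattice point after $v$ on $E_i$. Define \[C_{v,\gamma}=\operatorname{conv}\big(v,\ v+\gamma(w_{E_1}-v),\dots, v+\gamma(w_{E_d}-v)\big).\] $P$ is $k$-normal if every point of $kP\cap M$ is a sum of $k$ points of $P\cap M$. *)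

(* Defs.v *)
From HB Require Import structures.
From mathcomp Require Import all_boot all_order all_algebra.
From mathcomp Require Import boolp classical_sets functions cardinality reals.

Set Implicit Arguments.
Unset Strict Implicit.
Unset Printing Implicit Defensive.

Import Order.TTheory GRing.Theory Num.Theory.

Local Open Scope classical_set_scope.
Local Open Scope ring_scope.

Section LatticePolytopes.
Context {R : realType} {V : vectType R}.
Implicit Types (M P A F E : set V) (u v w x : V).

Definition conv A : set V :=
  [set x | exists (m : nat) (p : 'I_m -> V) (a : 'I_m -> R),
     [/\ forall i, A (p i), forall i, 0 <= a i, \sum_(i < m) a i = 1
       & x = \sum_(i < m) a i *: p i]].

Definition affine_hull A : set V :=
  [set x | exists (m : nat) (p : 'I_m -> V) (a : 'I_m -> R),
     [/\ forall i, A (p i), \sum_(i < m) a i = 1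
       & x = \sum_(i < m) a i *: p i]].

Definition has_dim A (m : nat) : Prop :=
  exists (x : V) (U : {vspace V}),
    \dim U = m /\ affine_hull A = [set x + u | u in [set` U]].

(* A lattice of rank d is represented inside its real span V, which plays the
   role of the tensor product of M with the reals. *)
Definition lattice (d : nat) M : Prop :=
  exists e : d.-tuple V,
    basis_of fullv e /\
    M = [set x | exists c : 'I_d -> int, x = \sum_(i < d) e`_i *~ c i].

Definition zbasis M (d : nat) (b : 'I_d -> V) : Prop :=
  (forall i, M (b i)) /\
  (forall x, M x ->
     exists! c : {ffun 'I_d -> int}, x = \sum_(i < d) b i *~ c i).

Definition lattice_polytope M P : Prop :=
  exists s : seq V, [set` s] `<=` M /\ P = conv [set` s].

Definition face P F : Prop :=
  exists (f : {scalar V}) (c : R),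
    (forall x, P x -> f x <= c) /\ F = P `&` [set x | f x = c].

Definition vertex P v : Prop := face P [set v].

Definition edge P E : Prop := face P E /\ has_dim E 1.

Definition edge_at P v E : Prop := edge P E /\ E v.

Definition first_lattice_point M v E w : Prop :=
  [/\ E w, M w, w != v
    & forall u, M u -> conv [set v; w] u -> u = v \/ u = w].

Definition smooth_at M (d : nat) P v : Prop :=
  exists (E : 'I_d -> set V) (w : 'I_d -> V),
    [/\ injective E,
        forall F, edge_at P v F <-> exists i, F = E i,
        forall i, first_lattice_point M v (E i) (w i)
      & zbasis M (fun i => w i - v)].

Definition smooth_polytope M (d : nat) P : Prop :=
  [/\ lattice_polytope M P, has_dim P d
    & forall v, vertex P v -> smooth_at M d P v].

(* The simplex C_{v,gamma} of P. *)
Definition corner_simplex M P v (gamma : int) : set V :=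
  conv (v |` [set v + gamma%:~R *: (w - v) |
                w in [set w | exists2 E, edge_at P v E
                                       & first_lattice_point M v E w]]).

Definition in_corner_simplices M P (gamma : int) : Prop :=
  forall v, vertex P v -> P `<=` corner_simplex M P v gamma.

Definition k_normal M P (k : nat) : Prop :=
  forall x, M x -> (exists2 y, P y & x = k%:R *: y) ->
    exists p : 'I_k -> V, (forall i, P (p i) /\ M (p i)) /\
                          x = \sum_(i < k) p i.

End LatticePolytopes.

(* Main.v *)
(* Put N = (gamma - 1)(d - 1) and write x in kP as a nonnegative combination, of
   total weight k, of the n vertices of P. Since k > N n, some vertex v has weight
   at least N, so x - N v lies in (k - N)P. A lattice point of mP with m >= d always
   has a lattice point of P as a summand with complement in (m - 1)P; hence
   x - N v = r + (sum of lattice points of P) with r a lattice point of lP, l <= d - 1.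
   In the Z-basis w_i - v at v, the vector r - l v has nonnegative integer coordinates,
   of sum at most gamma l <= l + N because P lies in C_{v,gamma}. So r + N v is a sum
   of l + N points among v and the w_i. *)
From HB Require Import structures.
Require Import Defs.
From mathcomp Require Import all_boot all_order all_algebra.
From mathcomp Require Import boolp classical_sets functions cardinality reals.
From mathcomp Require Import ring lra zify.

Set Implicit Arguments.
Unset Strict Implicit.
Unset Printing Implicit Defensive.

Import Order.TTheory GRing.Theory Num.Theory.
Local Open Scope classical_set_scope.
Local Open Scope ring_scope.

Section Dilates.
Context {R : realType} {V : vectType R}.
Implicit Types (A B M P : set V) (u v w x y : V) (s t : R).

(** * Combinations of prescribed weight and dilates of convex hulls *)

Definition combination A m t : set V :=
  [set x | exists (p : 'I_m -> V) (a : 'I_m -> R),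
     [/\ forall i, A (p i), forall i, 0 <= a i, \sum_(i < m) a i = t
       & x = \sum_(i < m) a i *: p i]].

(* [t * conv A]; [dilate A 1] is convertible to [conv A]. *)
Definition dilate A t : set V := [set x | exists m, combination A m t x].

Lemma dilate0 A : dilate A 0 0.
Proof.
by exists 0%N, (fun=> 0), (fun=> 0); split=> [[]|//||] //; rewrite !big_ord0.
Qed.

Lemma dilate_mem A x : A x -> dilate A 1 x.
Proof.
move=> Ax; exists 1%N, (fun=> x), (fun=> 1).
by split=> // [|]; rewrite big_ord1 ?scale1r.
Qed.

Lemma dilateD A s t x y :
  dilate A s x -> dilate A t y -> dilate A (s + t) (x + y).
Proof.
move=> [m [p [a [Ap a0 <- ->]]]] [n [q [b [Aq b0 <- ->]]]].
exists (m + n)%N, (fun i => match fintype.split i with inl j => p j | inr j => q j end).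
exists (fun i => match fintype.split i with inl j => a j | inr j => b j end).
split=> [i|i||]; first by case: (fintype.split i).
- by case: (fintype.split i).
- by rewrite big_split_ord/=; congr (_ + _); apply: eq_bigr => i _;
    rewrite (unsplitK (inl _)) || rewrite (unsplitK (inr _)).
- by rewrite big_split_ord/=; congr (_ + _); apply: eq_bigr => i _;
    rewrite (unsplitK (inl _)) || rewrite (unsplitK (inr _)).
Qed.

Lemma dilateZ A c t x : 0 <= c -> dilate A t x -> dilate A (c * t) (c *: x).
Proof.
move=> c0 [m [p [a [Ap a0 <- ->]]]]; exists m, p, (fun i => c * a i); split=> //.
- by move=> i; apply: mulr_ge0.
- by rewrite mulr_sumr.
- by rewrite scaler_sumr; apply: eq_bigr => i _; rewrite scalerA.
Qed.

Lemma dilateZ1 A c x : 0 <= c -> dilate A 1 x -> dilate A c (c *: x).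
Proof. by move=> c0 /(dilateZ c0); rewrite mulr1. Qed.

Lemma dilate_sum A (I : finType) (a : I -> R) (p : I -> V) :
  (forall i, 0 <= a i) -> (forall i, A (p i)) ->
  dilate A (\sum_i a i) (\sum_i a i *: p i).
Proof.
move=> a0 Ap; elim/big_ind2: _ => [||i _]; first exact: dilate0.
- by move=> *; apply: dilateD.
- by apply: dilateZ1 => //; apply: dilate_mem.
Qed.

Lemma dilate_trans A B t x :
  A `<=` dilate B 1 -> dilate A t x -> dilate B t x.
Proof.
move=> AB [m [p [a [Ap a0 <- ->]]]]; elim/big_ind2: _ => [||i _].
- exact: dilate0.
- by move=> *; apply: dilateD.
- by apply: dilateZ1 => //; apply: AB.
Qed.

(** Substituting combinations of weight at least 1 can only raise the total weight, so a positive
    weight stays positive. *)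
Lemma dilate_trans_ge A B t x :
  (forall u, A u -> exists2 r : R, 1 <= r & dilate B r u) ->
  dilate A t x -> exists2 r : R, t <= r & dilate B r x.
Proof.
move=> AB [m [p [a [Ap a0 <- ->]]]]; elim/big_ind2: _ => [||i _].
- by exists 0; last exact: dilate0.
- move=> s1 u1 s2 u2 [r1 sr1 B1] [r2 sr2 B2].
  by exists (r1 + r2); [apply: lerD|apply: dilateD].
- have [r r1 Br] := AB _ (Ap i); exists (a i * r); last exact: dilateZ.
  by rewrite ler_peMr.
Qed.

Lemma dilate_sub A B t x : A `<=` B -> dilate A t x -> dilate B t x.
Proof. by move=> AB; apply: dilate_trans => y /AB; apply: dilate_mem. Qed.

Lemma dilate_le A (f : {scalar V}) c t x :
  (forall u, A u -> f u <= c) -> dilate A t x -> f x <= c * t.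
Proof.
move=> fA [m [p [a [Ap a0 <- ->]]]].
rewrite linear_sum mulr_sumr; apply: ler_sum => i _.
by rewrite linearZ/= mulrC ler_wpM2r// fA.
Qed.

Lemma dilate_divr A t x : 0 < t -> dilate A t x -> dilate A 1 (t^-1 *: x).
Proof.
move=> t0 At; rewrite -(mulVf (lt0r_neq0 t0)).
by apply: dilateZ At; rewrite invr_ge0 ltW.
Qed.

(** * Linear functionals and Gordan's alternative *)

Lemma scalar_comb (f g : {scalar V}) (a : R) :
  exists h : {scalar V}, forall x, h x = f x + a * g x.
Proof.
pose h0 x : R := f x + a * g x.
have lin : linear_for *%R h0.
  by move=> c x y; rewrite /h0 !linearP/=; ring.
pose L := GRing.isLinear.Build R V R *%R h0 lin.
by exists (HB.pack_for {scalar V} h0 L).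
Qed.

Lemma scalar_neq0 x : x != 0 -> exists f : {scalar V}, 0 < f x.
Proof.
move=> x0; have [i ci|all0] := pickP (fun i => coord (vbasis fullv) i x != 0).
  pose f : {scalar V} := coord (vbasis fullv) i.
  have [h hE] := scalar_comb f f (f x - 1).
  exists h; have -> : h x = f x ^+ 2 by rewrite hE; ring.
  by rewrite exprn_even_gt0.
case/eqP: x0; rewrite (coord_vbasis (memvf x)) big1// => i _.
by move/negbFE/eqP: (all0 i) => ->; rewrite scale0r.
Qed.

Lemma perturb_gt0 (s : seq V) (f g : {scalar V}) :
  (forall u, u \in s -> 0 < f u) ->
  exists2 e : R, 0 < e & forall u, u \in s -> 0 < f u + e * g u.
Proof.
move=> fs.
(* Strengthened to all [d] in $(0,e]$ so that the induction can pass to a minimum. *)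
suff [e e0 He] : exists2 e : R, 0 < e & forall d u, 0 < d <= e -> u \in s ->
    0 < f u + d * g u.
  by exists e => // u us; apply: He => //; rewrite e0 lexx.
elim: s fs => [|v s IH] fs; first by exists 1.
have [|e e0 He] := IH; first by move=> u us; apply: fs; rewrite inE us orbT.
have fv : 0 < f v by apply: fs; rewrite mem_head.
have n0 : 0 < `|g v| + 1 by rewrite ltr_wpDl.
exists (Num.min e (f v / (`|g v| + 1))); first by rewrite lt_min e0 divr_gt0.
move=> d u /andP[d0]; rewrite le_min => /andP[de]; rewrite ler_pdivlMr// => dv.
rewrite inE => /orP[/eqP->|us]; last by apply: He => //; rewrite d0.
have : d * - g v <= d * `|g v| 
  by apply: ler_wpM2l; [exact: ltW|rewrite -normrN ler_norm].
by lra.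
Qed.

(* Induction on [s]: when the functional [f] found for the tail is negative at the
   head [q], the tail is projected along [q] onto [ker f]. *)
Lemma gordan (s : seq V) :
  (exists f : {scalar V}, forall u, u \in s -> 0 < f u) \/
  (exists2 t : R, 0 < t & dilate [set` s] t 0).
Proof.
have [m] := ubnP (size s); elim: m s => // m IH [|q s] /=.
  by move=> _; left; exists \0%R => //.
rewrite ltnS => sm; have [[f fs]|[t t0 st]] := IH _ sm; last first.
  by right; exists t => //; apply: dilate_sub st => u /=; rewrite inE => ->; rewrite orbT.
have [fq0|fq0|fq0] := ltgtP (f q) 0; last first.
- have [->|/scalar_neq0[h hq]] := eqVneq q 0.
    by right; exists 1 => //; apply: dilate_mem; rewrite /= mem_head.
  have [e e0 He] := perturb_gt0 h fs.
  have [k kE] := scalar_comb f h e; left; exists k => u; rewrite inE kE.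
  by case/orP => [/eqP->|/He//]; rewrite fq0 add0r mulr_gt0.
- left; exists f => u; rewrite inE => /orP[/eqP->//|]; exact: fs.
pose c u := - (f u / f q); pose r u := u + c u *: q.
have c0 u : u \in s -> 0 < c u.
  by move=> us; rewrite /c -mulrN -invrN divr_gt0 ?fs// oppr_gt0.
have [|[g gs]|[t t0 st]] := IH [seq r u | u <- s]; first by rewrite size_map.
(* [k] vanishes at [q] and takes at [u] the value of [g] at the projection [r u]. *)
- have [k kE] := scalar_comb g f (- (g q / f q)).
  have ks u : u \in s -> 0 < k u.
    move=> us; have := gs _ (map_f r us).
    by rewrite /r linearD linearZ/= kE /c; congr (0 < _); ring.
  have kq : k q = 0 by rewrite kE mulNr divfK ?subrr ?lt_eqF.
  (* [f'] is $-f$, positive at [q]; a small multiple of it makes [k] positive there too. *)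
  have [f' f'E] := scalar_comb f f (- 2).
  have [e e0 He] := perturb_gt0 f' ks.
  have [l lE] := scalar_comb k f' e; left; exists l => u; rewrite inE lE.
  case/orP => [/eqP->|/He//]; rewrite kq add0r mulr_gt0// f'E; lra.
(* A dependency among the projections lifts, since [r u] has weight $1+c(u)\ge 1$ over [q] and
   [s]. *)
have [|t' tt' qt'] := dilate_trans_ge (B := [set` q :: s]) _ st; last first.
  by right; exists t' => //; apply: lt_le_trans tt'.
move=> _ /= /mapP[u us ->]; exists (1 + c u).
  by rewrite lerDl ltW ?c0.
rewrite /r; apply: dilateD.
  by apply: dilate_mem; rewrite /= inE us orbT.
apply: dilateZ1; first by rewrite ltW ?c0.
by apply: dilate_mem; rewrite /= mem_head.
Qed.

(** * Vertices of a polytope *)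

Lemma dilate_reflect A t v x :
  dilate [set v - u | u in A] t x -> dilate A t (t *: v - x).
Proof.
move=> [m [p [a [Ap a0 <- ->]]]].
have /choice[q qA] i : exists u, A u /\ v - u = p i.
  by have [u Au <-] := Ap i; exists u.
exists m, q, a; split=> // [i|]; first by have [] := qA i.
rewrite scaler_suml -sumrB; apply: eq_bigr => i _.
by have [_ <-] := qA i; rewrite scalerBr opprB addrC subrK.
Qed.

Lemma vertex_of_functional (s : seq V) v (f : {scalar V}) :
  v \in s -> (forall u, u \in s -> u != v -> f u < f v) ->
  vertex (conv [set` s]) v.
Proof.
move=> vs fv.
have fle u : [set` s] u -> f u <= f v.
  by move=> us; have [->//|/(fv _ us)/ltW] := eqVneq u v.
exists f, (f v); split=> [x /(dilate_le fle)|]; first by rewrite mulr1.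
apply/seteqP; split=> [_ ->|x [[m [p [a [sp a0 a1 ->]]]] fx]] /=.
  by split=> //; apply: dilate_mem.
(* At a maximiser this sum of nonnegative terms vanishes, so only copies of [v] carry weight. *)
have z0 : \sum_i a i * (f v - f (p i)) = 0.
  under eq_bigr do rewrite mulrBr.
  rewrite sumrB -mulr_suml a1 mul1r -fx linear_sum; apply/eqP; rewrite subr_eq0.
  by apply/eqP/eq_bigr => i _; rewrite linearZ.
rewrite -[v]scale1r -a1 scaler_suml; apply: eq_bigr => i _.
have [->//|/(fv _ (sp i))] := eqVneq (p i) v; rewrite -subr_gt0 => fi.
have /eqP : a i * (f v - f (p i)) = 0.
  apply: (psumr_eq0P _ z0) => // j _; apply: mulr_ge0 => //.
  by rewrite subr_ge0; apply: fle.
by rewrite mulf_eq0 (gt_eqF fi) orbF => /eqP->; rewrite !scale0r.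
Qed.

(** Points in the hull of the others are discarded one by one. When none is left, Gordan's
    alternative for the differences $v-u$ must expose [v], since a dependency would put [v] in the
    hull of the others. *)
Lemma conv_eq_vertices (s : seq V) :
  uniq s -> exists s' : seq V, [/\ uniq s', {subset s' <= s}, conv [set` s'] = conv [set` s]
    & forall v, v \in s' -> vertex (conv [set` s]) v].
Proof.
have [m] := ubnP (size s); elim: m s => // m IH s; rewrite ltnS => sm us.
have [rv|] := pselect (exists2 v, v \in s & conv [set` rem v s] v); last first.
  move=> nrv; exists s; split=> // v vs.
  have [[f fs]|[t t0 st]] := gordan [seq v - u | u <- rem v s].
    apply: (vertex_of_functional (f := f)) => // u us' uv.
    rewrite -subr_gt0 -linearB; apply: fs; apply: map_f.
    by rewrite mem_rem_uniq// inE uv.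
  case: nrv; exists v => //.
  have : dilate [set` rem v s] t (t *: v - 0).
    apply: dilate_reflect; apply: dilate_sub st => w /= /mapP[u us' ->].
    by exists u.
  by rewrite subr0 => /(dilate_divr t0); rewrite scalerA mulVf ?gt_eqF// scale1r.
case: rv => v vs cv.
have [||s' [us' ss' cs' vs']] := IH (rem v s).
  by rewrite size_rem// (leq_trans _ sm)// ltn_predL; case: (s) vs.
  exact: rem_uniq.
have E : conv [set` rem v s] = conv [set` s].
  apply/seteqP; split=> x; apply: dilate_trans => u /= us1.
    by apply: dilate_mem; rewrite /= (mem_rem us1).
  have [->//|uv] := eqVneq u v.
  by apply: dilate_mem; rewrite /= mem_rem_uniq// inE uv.
rewrite E in cs' vs'; exists s'; split=> // x /ss'; exact: mem_rem.
Qed.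

Lemma seq_card_le (s : seq V) (B : set V) n :
  uniq s -> (forall x, x \in s -> B x) -> (B #= `I_n)%card -> (size s <= n)%N.
Proof.
move=> us sB; rewrite card_eq_le => /andP[Bn _]; rewrite -card_le_II.
apply: card_le_trans Bn.
have inj : {in `I_(size s) &, injective (nth 0 s)}.
  move=> i j /set_mem/= si /set_mem/= sj /eqP.
  by rewrite nth_uniq// => /eqP.
have /card_eqPle[+ _] := card_esym (inj_card_eq inj).
move=> /card_le_trans; apply; apply: subset_card_le => _ [i /= si <-].
by apply: sB; rewrite mem_nth.
Qed.

(** * Carathéodory's theorem *)

Lemma ratio_test (I : finType) (a c : I -> R) :
  (forall i, 0 <= a i) -> (exists i, 0 < c i) ->
  exists t i, [/\ 0 <= t, 0 < c i, a i = t * c i & forall j, t * c j <= a j].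
Proof.
move=> a0 [i0 ci0].
(* The minimum of $a_i/c_i$ over $c_i>0$ is the largest [t] that keeps $a-tc$ nonnegative. *)
have [i ci imin] := arg_minP (fun i => a i / c i) (ci0 : (fun i => 0 < c i) i0).
exists (a i / c i), i; split=> // [||j]; first by rewrite divr_ge0// ltW.
  by rewrite divfK// gt_eqF.
have [cj|cj] := ltP 0 (c j); first by rewrite -ler_pdivlMr//; apply: imin.
by apply: le_trans (a0 j); rewrite mulr_ge0_le0// divr_ge0// ltW.
Qed.

Lemma exists_gt0 (I : finType) (c : I -> R) i0 :
  \sum_i c i = 0 -> c i0 != 0 -> exists i, 0 < c i.
Proof.
move=> c0 ci0; apply: contrapT => /forallNP npos.
have le0 i : c i <= 0 by rewrite leNgt; apply/negP.
suff : - c i0 = 0 by move/eqP; rewrite oppr_eq0 (negbTE ci0).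
apply: (psumr_eq0P (P := xpredT) (F := fun i => - c i)) => //.
  by move=> i _; rewrite oppr_ge0.
by rewrite sumrN c0 oppr0.
Qed.

Lemma combination_widen A m t x y :
  A y -> combination A m t x -> combination A m.+1 t x.
Proof.
move=> Ay [p [a [Ap a0 <- ->]]].
exists (fun i => if unlift ord0 i is Some j then p j else y).
exists (fun i => if unlift ord0 i is Some j then a j else 0).
split=> [i|i||]; try by case: (unlift ord0 i).
- rewrite big_ord_recl unlift_none add0r; apply: eq_bigr => i _.
  by rewrite liftK.
- rewrite big_ord_recl unlift_none scale0r add0r; apply: eq_bigr => i _.
  by rewrite liftK.
Qed.

(** The weights move along the affine dependency [c] until one of them reaches 0; this changes
    neither the total nor the point. *)
Lemma eliminate_weight (I : finType) (p : I -> V) (a c : I -> R) i0 :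
  (forall i, 0 <= a i) -> \sum_i c i = 0 -> \sum_i c i *: p i = 0 -> c i0 != 0 ->
  exists b : I -> R, [/\ forall i, 0 <= b i, \sum_i b i = \sum_i a i,
    \sum_i b i *: p i = \sum_i a i *: p i & exists i, b i = 0].
Proof.
move=> a0 c0 cp0 ci0; have [t [i [t0 ci ai le]]] := ratio_test a0 (exists_gt0 c0 ci0).
exists (fun j => a j - t * c j); split.
- by move=> j; rewrite subr_ge0.
- by rewrite sumrB -mulr_sumr c0 mulr0 subr0.
- under eq_bigr do rewrite scalerBl -scalerA.
  by rewrite sumrB -scaler_sumr cp0 scaler0 subr0.
- by exists i; rewrite ai subrr.
Qed.

(* The rows are [(1, p i)], so that the left kernel consists of the affine
   dependencies of [p]. *)
Definition homog_mx d (e : d.-tuple V) m (p : 'I_m -> V) : 'M[R]_(m, 1 + d) :=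
  row_mx (const_mx 1) (\matrix_(i, j) coord e j (p i)).

Lemma homog_mx_row d (e : d.-tuple V) m (p : 'I_m -> V) i :
  row i (homog_mx e p) = row_mx (const_mx 1) (\row_j coord e j (p i)).
Proof.
by rewrite row_row_mx; congr row_mx; apply/rowP => j; rewrite !mxE.
Qed.

Section Coordinates.
Variables (d : nat) (e : d.-tuple V).
Hypothesis e_basis : basis_of fullv e.

Lemma mul_homog_mx m (p : 'I_m -> V) (c : 'rV_m) :
  c *m homog_mx e p =
  row_mx (const_mx (\sum_i c 0 i)) (\row_j coord e j (\sum_i c 0 i *: p i)).
Proof.
rewrite mul_mx_row; congr row_mx; apply/rowP => j; rewrite !mxE.
  by apply: eq_bigr => i _; rewrite mxE mulr1.
by rewrite linear_sum; apply: eq_bigr => i _; rewrite mxE linearZ.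
Qed.

Lemma homog_mx_ker m (p : 'I_m -> V) (c : 'rV_m) :
  c *m homog_mx e p = 0 -> \sum_i c 0 i = 0 /\ \sum_i c 0 i *: p i = 0.
Proof.
rewrite mul_homog_mx -(row_mx0 R 1 1 d) => /eq_row_mx[c0 cp0].
have /rowP/(_ ord0) := c0; rewrite !mxE => c1; split=> //.
rewrite [LHS](coord_basis e_basis (memvf _)) big1// => i _.
have /rowP/(_ i) := cp0; rewrite !mxE => ->; exact: scale0r.
Qed.

Lemma combination_shrink A m t x :
  (d < m)%N -> combination A m.+1 t x -> combination A m t x.
Proof.
move=> dm [p [a [Ap a0 <- ->]]].
(* There are $m+1$ rows but only $1+d\le m$ columns. *)
have : kermx (homog_mx e p) != 0.
  rewrite kermx_eq0 /row_free neq_ltn ltnS (leq_trans (rank_leq_col _))//.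
rewrite -nz_row_eq0; set c := nz_row _ => c0.
have /homog_mx_ker[cs cp] : c *m homog_mx e p = 0 by apply/sub_kermxP/nz_row_sub.
have [i ci] : exists i, c 0 i != 0 by apply/rV0Pn.
have [b [b0 bs bp [j bj]]] := eliminate_weight a0 cs cp ci.
exists (fun i => p (lift j i)), (fun i => b (lift j i)); split=> //.
  by rewrite -bs (bigD1_ord j)//= bj add0r.
by rewrite -bp (bigD1_ord j)//= bj scale0r add0r.
Qed.

(** Exactly $d+1$ points, padded with weight 0 if necessary, make [homog_mx] square. The condition
    $t>0$ excludes the empty combination and so yields a point of [A] for the padding. *)
Lemma caratheodory A t x : 0 < t -> dilate A t x -> combination A d.+1 t x.
Proof.
move=> t0 [m [p [a Hpa]]].
have [y Ay] : A !=set0.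
  case: Hpa => Ap _ at_ _; case: m p a Ap at_ => [|m] p a Ap at_.
    by move: at_ t0; rewrite big_ord0 => <-; rewrite ltxx.
  by exists (p ord0).
have : combination A m t x by exists p, a.
have [/subnK <-|/subnK <-] := leqP m d.+1.
  elim: (d.+1 - m)%N => // k IH /IH; exact: (combination_widen Ay).
elim: (m - d.+2)%N => [|k IH].
  by apply: combination_shrink.
by rewrite addSn => /combination_shrink Hc; apply: IH; apply: Hc; lia.
Qed.

End Coordinates.

(** * Splitting lattice points off a dilate *)

Lemma det_replace_row (n : nat) (A B : 'M[R]_n) (c : 'rV_n) i0 :
  (forall i, i != i0 -> row i B = row i A) -> row i0 B = c *m A ->
  \det B = c 0 i0 * \det A.
Proof.
move=> BA Bi0.
(* Expansion along row [i0]: its cofactors are those of [A], whence the adjugate of [A]. *)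
have -> : \det B = (c *m A *m \adj A) 0 i0.
  rewrite (expand_det_row B i0) mxE; apply: eq_bigr => j _; congr (_ * _).
    by rewrite -Bi0 mxE.
  rewrite mxE /cofactor; congr (_ * \det _); apply/matrixP => i k.
  have ni : lift i0 i != i0 by rewrite eq_sym neq_lift.
  by have /rowP/(_ (lift j k)) := BA _ ni; rewrite !mxE.
by rewrite -mulmxA mul_mx_adj mul_mx_scalar mxE mulrC.
Qed.

Section Lattice.
Variables (d : nat) (M : set V).
Hypothesis M_lattice : lattice d M.

Lemma lattice0 : M 0.
Proof.
case: M_lattice => e [_ ->]; exists (fun=> 0).
by rewrite big1// => i _; rewrite mulr0z.
Qed.

Lemma latticeB x y : M x -> M y -> M (x - y).
Proof.
case: M_lattice => e [_ ->] [c ->] [c' ->]; exists (fun i => c i - c' i).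
by rewrite -sumrB; apply: eq_bigr => i _; rewrite mulrzBr.
Qed.

Lemma latticeD x y : M x -> M y -> M (x + y).
Proof.
by move=> Mx My; rewrite -[y]opprK -[- y]sub0r; do 2?apply: latticeB => //; apply: lattice0.
Qed.

Lemma latticeMn x n : M x -> M (x *+ n).
Proof.
move=> Mx; elim: n => [|n IH]; first exact: lattice0.
by rewrite mulrS; apply: latticeD.
Qed.

Lemma lattice_sum (I : finType) (F : I -> V) :
  (forall i, M (F i)) -> M (\sum_i F i).
Proof.
by move=> MF; elim/big_ind: _ => //; [apply: lattice0|apply: latticeD].
Qed.

Lemma lattice_coord : exists2 e : d.-tuple V, basis_of fullv e &
  forall x, M x -> forall i, coord e i x \is a Num.int.
Proof.
case: M_lattice => e [eb ->]; exists e => // _ [c ->] i.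
have -> : \sum_(i < d) e`_i *~ c i = \sum_(i < d) (c i)%:~R *: e`_i.
  by apply: eq_bigr => j _; rewrite scaler_int.
by rewrite coord_sum_free ?(basis_free eb)// intr_int.
Qed.

Lemma det_homog_int (e : d.-tuple V) (p : 'I_d.+1 -> V) :
  (forall i j, coord e j (p i) \is a Num.int) ->
  \det (homog_mx e p) \is a Num.int.
Proof.
move=> ep; rewrite /determinant; apply: rpred_sum => s _; rewrite rpredMsign; apply: rpred_prod => i _.
by rewrite mxE; case: split_ordP => j _; rewrite mxE ?rpred1 ?ep.
Qed.

(** Otherwise the [d] remaining weights are all below 1 and add up to less than [d]; here $d\ge 1$
    makes the sum nonempty and the inequality strict. *)
Lemma zero_weight (a : 'I_d.+1 -> R) i0 :
  (1 <= d)%N -> a i0 = 0 -> d%:R <= \sum_i a i -> exists i, 1 <= a i.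
Proof.
move=> d1 a0 da; apply: contrapT => /forallNP a1.
have lt1 i : a i < 1 by rewrite ltNge; apply/negP.
move: da; rewrite (bigD1_ord i0)//= a0 add0r leNgt; case/negP.
rewrite -[d in d%:R]card_ord -sumr_const; apply: ltr_sum => //.
by apply/hasP; exists (Ordinal d1); rewrite ?mem_index_enum.
Qed.

(* If all weights are below 1, then [m = d] and [y = \sum_i (1 - a i) *: p i] is a
   lattice point in the interior of the simplex on [p]; trading one of the [p i]
   for [y] makes the determinant, an integer, strictly smaller. *)
Lemma big_weight (A : set V) (m : nat) x :
  (1 <= d)%N -> A `<=` M -> (forall y, dilate A 1 y -> M y -> A y) ->
  (d <= m)%N -> M x -> dilate A m%:R x ->
  exists (p : 'I_d.+1 -> V) (a : 'I_d.+1 -> R),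
   [/\ forall i, A (p i), forall i, 0 <= a i, \sum_i a i = m%:R,
       x = \sum_i a i *: p i & exists i, 1 <= a i].
Proof.
move=> d1 AM Acl dm Mx Ax.
have [e eb eM] := lattice_coord.
have m0 : 0 < m%:R :> R by rewrite ltr0n (leq_trans d1).
have [p [a []]] := caratheodory eb m0 Ax.
have dmR : d%:R <= m%:R :> R by rewrite ler_nat.
have : exists N : nat, `|\det (homog_mx e p)| < N%:R.
  by eexists; apply: archi_boundP.
case=> N; elim: N p a => [|N IH] p a ltN Ap a0 am xE; first by rewrite ltNge normr_ge0 in ltN.
have [nz|/forallNP lt1'] := pselect (exists i, 1 <= a i); first by exists p, a.
have lt1 i : a i < 1 by rewrite ltNge; apply/negP.
have apos i : 0 < a i.
  rewrite lt_neqAle a0 andbT eq_sym; apply/eqP => ai0.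
  by case: (zero_weight d1 ai0) => [|j /lt1']; rewrite ?am.
(* A vanishing determinant gives an affine dependency; eliminating one weight leaves [d] weights of
   total $m\ge d$, one of them at least 1. *)
have [/eqP/det0P[c c0 /(homog_mx_ker eb)[cs cp]]|det0] := eqVneq (\det (homog_mx e p)) 0.
  have [i ci] : exists i, c 0 i != 0 by apply/rV0Pn.
  have [b [b0 bs bp [j bj]]] := eliminate_weight a0 cs cp ci.
  exists p, b; split=> //; [by rewrite bs|by rewrite bp|].
  by apply: (zero_weight d1 bj); rewrite bs am.
pose c := \row_i (1 - a i).
have c0 i : 0 < c 0 i by rewrite mxE subr_gt0.
have csE : \sum_i c 0 i = d.+1%:R - m%:R.
  under eq_bigr do rewrite mxE.
  by rewrite sumrB sumr_const card_ord am.
(* The $1-a_i$ are positive with sum $d+1-m$, so $m\le d$. *)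
have md : m = d.
  apply/eqP; rewrite eqn_leq dm andbT -ltnS -(ltr_nat R) -subr_gt0 -csE.
  rewrite big_ord_recl ltr_pwDl ?sumr_ge0// => i _; exact: ltW.
have cs : \sum_i c 0 i = 1 by rewrite csE md -natr1 addrC addKr.
pose y := \sum_i c 0 i *: p i.
have yE : y = \sum_i p i - x.
  by rewrite xE -sumrB; apply: eq_bigr => i _; rewrite mxE scalerBl scale1r.
have Ay : A y.
  apply: Acl; first by rewrite -cs; apply: dilate_sum => // i; apply: ltW.
  by rewrite yE; apply: latticeB => //; apply: lattice_sum => i; apply: AM.
(* The index [i0] minimises $a_i/(1-a_i)$, so putting [y] with weight [t] in its place keeps the
   other weights nonnegative. *)
have [|t [i0 [t0 _ ai0 tle]]] := ratio_test (c := fun i => c 0 i) a0.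
  by exists ord0.
pose p' i := if i == i0 then y else p i.
pose a' i := if i == i0 then t else a i - t * c 0 i.
have [Ap' a'0] : (forall i, A (p' i)) /\ (forall i, 0 <= a' i).
  by split=> i; rewrite /p' /a'; case: eqP => // _; rewrite subr_ge0.
(* Stated for any module [W]: with all [q] equal to 1 it gives the total weight, with $q=p$ the
   point [x]. *)
have sumE (W : lmodType R) (q q' : 'I_d.+1 -> W) :
  (forall i, i != i0 -> q' i = q i) -> q' i0 = \sum_i c 0 i *: q i ->
  \sum_i a' i *: q' i = \sum_i a i *: q i.
  move=> qq qi0; rewrite (bigD1 i0)//= qi0 /a' eqxx.
  under eq_bigr => i ni do rewrite (negbTE ni) qq// scalerBl -scalerA.
  rewrite sumrB -scaler_sumr [in RHS](bigD1 i0)//= ai0.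
  rewrite [\sum_i c 0 i *: _](bigD1 i0)//= scalerDr scalerA -addrA.
  by congr (_ + _); rewrite addrCA subrr addr0.
apply: (IH p' a') => //.
- have detE : \det (homog_mx e p') = c 0 i0 * \det (homog_mx e p).
    apply: det_replace_row => [i ni|].
      apply: etrans (homog_mx_row _ _ _) (etrans _ (esym (homog_mx_row _ _ _))).
      by rewrite /p' (negbTE ni).
    apply: etrans (homog_mx_row _ _ _) (etrans _ (esym (mul_homog_mx _ _ _))).
    by rewrite cs /p' eqxx.
  have intD q : (forall i, A (q i)) -> \det (homog_mx e q) \is a Num.int.
    by move=> Aq; apply: det_homog_int => i j; apply: eM; apply: AM.
  have lt : `|\det (homog_mx e p')| < `|\det (homog_mx e p)|.
    rewrite detE normrM gtr_pMl ?normr_gt0// gtr0_norm// mxE.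
    by rewrite ltrBlDr ltrDl.
  move: lt ltN; have /intrP[z ->] := intD _ Ap; have /intrP[z' ->] := intD _ Ap'.
  by rewrite -!intr_norm (pmulrn 1 N.+1) (pmulrn 1 N) !ltr_int; lia.
- rewrite -am; have := sumE R^o (fun=> 1) (fun=> 1) (fun _ _ => erefl).
  have one (b : 'I_d.+1 -> R) : \sum_i b i *: (1 : R^o) = \sum_i b i.
    by apply: eq_bigr => i _; rewrite -[RHS]mulr1.
  by rewrite !one; apply.
- rewrite xE; apply/esym/sumE => [i ni|]; first by rewrite /p' (negbTE ni).
  by rewrite /p' eqxx.
Qed.

Definition nsum (A : set V) (k : nat) : set V :=
  [set x | exists p : 'I_k -> V, (forall i, A (p i)) /\ x = \sum_(i < k) p i].

Lemma nsum0 A : nsum A 0 0.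
Proof. by exists (fun=> 0); split; [case|rewrite big_ord0]. Qed.

Lemma nsumD A k l x y : nsum A k x -> nsum A l y -> nsum A (k + l) (x + y).
Proof.
move=> [p [Ap ->]] [q [Aq ->]].
exists (fun i => match fintype.split i with inl j => p j | inr j => q j end).
split=> [i|]; first by case: (fintype.split i).
by rewrite big_split_ord/=; congr (_ + _); apply: eq_bigr => i _;
  rewrite (unsplitK (inl _)) || rewrite (unsplitK (inr _)).
Qed.

Lemma nsumMn A k x : A x -> nsum A k (x *+ k).
Proof. by move=> Ax; exists (fun=> x); rewrite sumr_const card_ord. Qed.

Lemma nsum_sum A (I : finType) (k : I -> nat) (x : I -> V) :
  (forall i, A (x i)) -> nsum A (\sum_i k i) (\sum_i x i *+ k i).
Proof.
move=> Ax; elim/big_ind2: _ => [||i _]; first exact: nsum0.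
- by move=> *; apply: nsumD.
- exact: nsumMn.
Qed.

(** As long as $m\ge d$, a point of weight at least 1 is split off and its weight drops by 1; for
    $m<d$ the remainder is [x] itself. *)
Lemma peel (A : set V) (m : nat) x :
  (1 <= d)%N -> A `<=` M -> (forall y, dilate A 1 y -> M y -> A y) ->
  M x -> dilate A m%:R x ->
  exists (l : nat) (r : V), [/\ (l < d)%N, (l <= m)%N, M r, dilate A l%:R r
    & nsum A (m - l) (x - r)].
Proof.
move=> d1 AM Acl; elim: m x => [|m IH] x Mx Ax.
  by exists 0%N, x; split=> //; rewrite subrr; apply: nsum0.
have [dm|md] := leqP d m.+1; last first.
  by exists m.+1, x; split=> //; rewrite subrr subnn; apply: nsum0.
have [p [a [Ap a0 am xE [i ai]]]] := big_weight d1 AM Acl dm Mx Ax.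
have [|| l [r [ld lm Mr Ar sr]]] := IH (x - p i).
- by apply: latticeB => //; apply: AM.
- have -> : x - p i = \sum_j (a j - (j == i)%:R) *: p j.
    under eq_bigr do rewrite scalerBl; rewrite sumrB -xE; congr (_ - _).
    rewrite (bigD1 i)//= eqxx scale1r big1 ?addr0// => j /negbTE->.
    exact: scale0r.
  have -> : m%:R = \sum_j (a j - (j == i)%:R).
    rewrite sumrB am -natr1 (bigD1 i)//= eqxx big1 ?addr0 ?addrK// => j /negbTE->//.
  apply: (dilate_sum (a := fun j => a j - (j == i)%:R)) => // j; rewrite subr_ge0; case: eqP => [->//|_]; exact: a0.
exists l, r; split=> //; first exact: leqW.
rewrite subSn// -addn1 (_ : x - r = x - p i - r + p i *+ 1).
  by apply: nsumD => //; apply: nsumMn.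
by rewrite mulr1n addrAC subrK.
Qed.

End Lattice.

(** * Pigeonhole on the vertices *)

Lemma dilate_seq (s : seq V) t x : dilate [set` s] t x ->
  exists c : 'I_(size s) -> R, [/\ forall i, 0 <= c i, \sum_i c i = t
    & x = \sum_i c i *: s`_i].
Proof.
move=> [m [p [a [sp a0 <- ->]]]]; elim/big_ind2: _ => [||j _].
- exists (fun=> 0); split=> //; first by rewrite big1.
  by rewrite big1// => i _; rewrite scale0r.
- move=> _ _ _ _ [c [c0 <- ->]] [c' [c'0 <- ->]].
  exists (fun i => c i + c' i); split=> [i||]; first exact: addr_ge0.
    by rewrite big_split.
  by rewrite -big_split; apply: eq_bigr => i _; rewrite scalerDl.
have pj : (index (p j) s < size s)%N by rewrite index_mem; apply: sp.
pose i0 := Ordinal pj; exists (fun i => if i == i0 then a j else 0); split.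
- by move=> i; case: ifP.
- by rewrite -big_mkcond big_pred1_eq.
- rewrite (bigD1 i0)//= eqxx nth_index; last exact: sp.
  by rewrite big1 ?addr0// => i /negbTE->; rewrite scale0r.
Qed.

(** Weights all below [N] would have total at most $N\cdot n<k$. A vertex of weight at least [N] can
    give up [N] copies. *)
Lemma heavy_vertex (s : seq V) (n N k : nat) x :
  (size s <= n)%N -> (N * n < k)%N -> dilate [set` s] k%:R x ->
  exists2 v, v \in s & dilate [set` s] (k - N)%:R (x - v *+ N).
Proof.
move=> sn Nk /dilate_seq[c [c0 ck ->]].
have [i ci] : exists i, N%:R <= c i.
  apply: contrapT => /forallNP cN; move: Nk; rewrite ltnNge => /negP; apply.
  rewrite -(ler_nat R) -ck.
  apply: (@le_trans _ _ (\sum_(i < size s) N%:R)).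
    by apply: ler_sum => i _; rewrite ltW// ltNge; apply/negP.
  by rewrite sumr_const card_ord -mulrnA ler_nat leq_mul2l sn orbT.
exists s`_i; first exact: mem_nth.
(* A nonempty list gives $n>0$, hence $N\le Nn<k$, and [k - N] is not truncated. *)
have n0 : (0 < n)%N by apply: leq_trans sn; case: (size s) i {ci} => // -[].
have Nlek : (N <= k)%N by apply: leq_trans (ltnW Nk); rewrite leq_pmulr.
have -> : \sum_j c j *: s`_j - s`_i *+ N = \sum_j (c j - N%:R *+ (j == i)) *: s`_j.
  under [RHS]eq_bigr do rewrite scalerBl; rewrite sumrB; congr (_ - _).
  rewrite (bigD1 i)//= eqxx big1 ?addr0 ?scaler_nat// => j /negbTE->.
  exact: scale0r.
have -> : (k - N)%:R = \sum_j (c j - N%:R *+ (j == i)).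
  rewrite natrB// sumrB ck (bigD1 i)//= eqxx big1 ?addr0// => j /negbTE->//.
apply: (dilate_sum (a := fun j => c j - N%:R *+ (j == i)) (p := fun j => s`_j)) => [j|j]; last exact: mem_nth.
by rewrite subr_ge0; case: eqP => [->//|_]; apply: c0.
Qed.

(** * Lattice coordinates at a smooth vertex *)

Lemma scalar_sum (I : finType) (f : I -> {scalar V}) :
  exists h : {scalar V}, forall x, h x = \sum_i f i x.
Proof.
pose h0 x : R := \sum_i f i x.
have lin : linear_for *%R h0.
  move=> c x y; rewrite /h0 mulr_sumr -big_split; apply: eq_bigr => i _.
  by rewrite linearP.
pose L := GRing.isLinear.Build R V R *%R h0 lin.
by exists (HB.pack_for {scalar V} h0 L).
Qed.

Lemma dilate_ge A (f : {scalar V}) c t x :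
  (forall u, A u -> c <= f u) -> dilate A t x -> c * t <= f x.
Proof.
have [g gE] := scalar_comb \0 f (- 1); move=> fA Ax.
have gA u : A u -> g u <= - c by move=> /fA; rewrite gE /= => ?; lra.
by have := dilate_le gA Ax; rewrite gE /=; lra.
Qed.

(** The family generates [M], hence spans [V], and has as many members as the dimension. *)
Lemma zbasis_basis (M : set V) d (b : 'I_d -> V) :
  lattice d M -> zbasis M b -> basis_of fullv (mktuple b).
Proof.
move=> [e [eb ME]] [_ bM]; have dimV : \dim {:V} = d by rewrite -(size_basis eb) ?size_tuple.
rewrite basisEdim size_tuple dimV leqnn andbT.
rewrite -(span_basis eb); apply/span_subvP => _ /tnthP[i ->].
have Mei : M (tnth e i).
  rewrite ME; exists (fun j => (j == i)%:Z).
  rewrite (bigD1 i)//= eqxx mulr1z big1 ?addr0 -?tnth_nth// => j /negbTE->.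
  by rewrite mulr0z.
have [c [-> _]] := bM _ Mei; apply: rpred_sum => j _; apply: rpredMz.
by apply: memv_span; apply/tnthP; exists j; rewrite tnth_mktuple.
Qed.

(** The point [w'] lies on the segment from [v] to [w], where the only lattice points are the
    ends. *)
Lemma first_lattice_point_shorter (M : set V) v (E : set V) w w' t :
  0 <= t <= 1 -> w' - v = t *: (w - v) ->
  first_lattice_point M v E w -> first_lattice_point M v E w' -> w' = w.
Proof.
move=> /andP[t0 t1] wE [_ _ _ wmin] [_ Mw' w'v _].
case: (wmin w') => [//||w'v'|//]; last by rewrite w'v' eqxx in w'v.
have -> : w' = (1 - t) *: v + t *: w.
  by rewrite -[w'](subrK v) wE scalerBr scalerBl scale1r addrC addrA addrAC.
suff : dilate [set v; w] (1 - t + t) ((1 - t) *: v + t *: w) by rewrite subrK.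
by apply: dilateD; (apply: dilateZ1; first lra); apply: dilate_mem; [left|right].
Qed.

(** An edge has dimension 1, so $w'-v=t(w-v)$; the functional exposing [v] is negative on both
    vectors, so $t>0$, and minimality of the longer one makes them equal. This identifies the
    generators of the corner simplex with the basis at [v]. *)
Lemma first_lattice_point_unique (M P : set V) v (E : set V) w w' :
  vertex P v -> edge_at P v E ->
  first_lattice_point M v E w -> first_lattice_point M v E w' -> w' = w.
Proof.
move=> [f [c [fP vE]]] [[[g [c' [_ EE]]] [x0 [U [dU hullE]]]] Ev] Fw Fw'.
have inU u u' : E u -> E u' -> u - u' \in U.
  have hull z : E z -> exists2 y, y \in U & z = x0 + y.
    move=> Ez; have : affine_hull E z.
      exists 1%N, (fun=> z), (fun=> 1).
      by split=> [//||]; rewrite big_ord1 ?scale1r.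
    by rewrite hullE => -[y /= yU <-]; exists y.
  move=> /hull[y yU ->] /hull[y' yU' ->].
  by rewrite opprD addrACA subrr add0r rpredB.
have neg u : first_lattice_point M v E u -> f (u - v) < 0.
  move=> [Eu _ uv _].
  have [_ /= fv] : (P `&` [set x | f x = c]) v by rewrite -vE.
  have Pu : P u by move: Eu; rewrite EE => -[].
  rewrite linearB/= fv subr_lt0 lt_neqAle fP// andbT.
  apply: contraNneq uv => fu; apply/eqP.
  by have : (P `&` [set x | f x = c]) u by []; rewrite -vE.
have [Ew _ wv _] := Fw; have [Ew' _ w'v _] := Fw'.
have UE : <[w - v]>%VS = U.
  apply/eqP; rewrite eqEdim -memvE inU//= dU dim_vline subr_eq0 wv//.
have /vlineP[t tE] : w' - v \in <[w - v]>%VS by rewrite UE inU.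
have t0 : 0 < t.
  by have := neg _ Fw'; rewrite tE linearZ/= nmulr_llt0// neg.
have [t1|t1] := leP t 1.
  by apply: (first_lattice_point_shorter _ tE Fw Fw'); rewrite ltW.
apply/esym/(first_lattice_point_shorter (t := t^-1) _ _ Fw' Fw).
  by rewrite invr_ge0 ltW//= invf_le1// ltW.
by rewrite tE scalerA mulVf ?scale1r// gt_eqF.
Qed.

(** Here [b] consists of the primitive edge vectors at [v], the [f i] are the dual coordinates and
    [h] is their sum. The bounds are linear, so on [P] they follow from the generators of the corner
    simplex. *)
Lemma corner_coordinates (M P : set V) d (gamma : int) v :
  (1 <= d)%N -> lattice d M -> vertex P v -> smooth_at M d P v ->
  P `<=` corner_simplex M P v gamma ->
  exists (b : 'I_d -> V) (f : 'I_d -> {scalar V}) (h : {scalar V}),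
  [/\ forall i, P (v + b i) /\ M (v + b i),
      forall x, x = \sum_i f i x *: b i,
      forall x i, M x -> f i x \is a Num.int,
      (forall x, h x = \sum_i f i x) /\
      (forall y, P y -> h y <= h v + gamma%:~R /\ forall i, f i v <= f i y)
    & 1 <= gamma].
Proof.
move=> d1 ML Pv [E [w [_ edgeE wE bZ]]] PC.
pose b i := w i - v; have bb := zbasis_basis ML bZ.
pose f i : {scalar V} := coord (mktuple b) i.
have [h hE] := scalar_sum f.
have bE (i : 'I_d) : (mktuple b)`_i = b i by rewrite -tnth_nth tnth_mktuple.
have fb i j : f i (b j) = (j == i)%:R.
  by rewrite -(bE j) [LHS]coord_free ?(basis_free bb)// eq_sym.
have hb j : h (b j) = 1.
  rewrite hE (bigD1 j)//= fb eqxx big1 ?addr0// => i /negbTE ij.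
  by rewrite fb eq_sym ij.
have Pw i : P (w i).
  have [[[g [c [_ EE]]] _] _] : edge_at P v (E i) by apply/edgeE; exists i.
  by have [+ _ _ _] := wE i; rewrite EE => -[].
have gens u : (v |` [set v + gamma%:~R *: (w - v) |
     w in [set w | exists2 E, edge_at P v E & first_lattice_point M v E w]]) u ->
     u = v \/ exists i, u = v + gamma%:~R *: b i.
  move=> [->|[w1 [F eF Fw] <-]]; [by left|right].
  have [i FE] := (edgeE F).1 eF; exists i; congr (_ + _ *: (_ - _)).
  by apply: first_lattice_point_unique Pv eF _ Fw; rewrite FE.
have hP (k : {scalar V}) c : 0 <= c -> (forall i, gamma%:~R * k (b i) <= c) ->
    forall y, P y -> k y <= k v + c.
  move=> c0 kb y /PC; rewrite -[_ + c]mulr1; apply: dilate_le => u /gens[->|[i ->]].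
    by rewrite lerDl.
  by rewrite linearD linearZ lerD2l kb.
(* If $\gamma\le 0$, coordinate [i0] would on [P] be at most its value at [v], but at [w i0] it is
   larger by 1. *)
have gamma1 : 1 <= gamma.
  have [//|gamma0] : 1 <= gamma \/ gamma <= 0 by lia.
  pose i0 : 'I_d := Ordinal d1.
  have : f i0 (w i0) <= f i0 v + 0.
    apply: hP => // i; rewrite fb mulr_le0_ge0// lerz0//.
  have -> : w i0 = v + b i0 by rewrite addrC subrK.
  by rewrite linearD/= fb eqxx addr0 gerDl ler10.
exists b, f, h; split=> //.
- move=> i; rewrite addrC subrK; split=> //; by have [] := wE i.
- by move=> x; rewrite [LHS](coord_basis bb (memvf x)); apply: eq_bigr => i _; rewrite bE.
- move=> x i Mx; have [c [-> _]] := bZ.2 _ Mx.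
  rewrite linear_sum rpred_sum// => j _; rewrite -scaler_int linearZ/= -/(b j) fb.
  by rewrite rpredM ?intr_int ?rpred_nat.
- split=> // y Py; split.
    by apply: hP => // [|i]; rewrite ?hb ?mulr1 // ler0z; apply: le_trans gamma1.
  move=> i; have [g gE] := scalar_comb \0 (f i) (- 1).
  have := hP g 0 (lexx _) _ _ Py; rewrite !gE /= addr0 !add0r !mulN1r lerN2; apply.
  move=> j; rewrite gE /= add0r fb mulN1r mulrN oppr_le0 mulr_ge0//.
  by rewrite ler0z; apply: le_trans gamma1.
Qed.

End Dilates.

(** * Writing a lattice point of $kP$ as a sum of $k$ lattice points of $P$ *)

Theorem corollary1p2 (R : realType) (V : vectType R) (d n : nat)
    (M P : set V) (gamma : int)
    (d_ge1 : (1 <= d)%N)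
    (M_lattice : lattice d M)
    (P_smooth : smooth_polytope M d P)
    (P_vertices : ([set v | vertex P v] #= `I_n)%card)
    (gamma_in : in_corner_simplices M P gamma)
    (gamma_min : forall g : int, in_corner_simplices M P g -> gamma <= g)
    (k : nat) :
  (gamma - 1) * (d%:Z - 1) * n%:Z + 1 <= k%:Z -> k_normal M P k.
Proof.
have [[s0 [s0M PE]] _ smoothP] := P_smooth.
have [s [us ss sP sv]] := conv_eq_vertices (undup_uniq s0).
have s0E : [set` undup s0] = [set` s0] by apply/seteqP; split=> x /=; rewrite mem_undup.
rewrite s0E -PE in sP sv.
have sM v : v \in s -> M v by move=> /ss; rewrite mem_undup => /s0M.
have size_s : (size s <= n)%N by apply: seq_card_le us sv P_vertices.
pose A := P `&` M.
have sA v : v \in s -> A v by move=> vs; split; [rewrite -sP; apply: dilate_mem|apply: sM].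
have corner v (vs : v \in s) :=
  corner_coordinates d_ge1 M_lattice (sv v vs) (smoothP v (sv v vs)) (gamma_in v (sv v vs)).
move=> kge x Mx [y Py xE].
(* A vertex exists because [P] contains [y]; the corner at it gives $\gamma\ge 1$, so $\gamma-1$ is
   a natural number [g]. *)
have [v0 v0s] : exists v, v \in s.
  have : dilate [set` s] 1 y by rewrite -sP in Py.
  move=> /dilate_seq[c [_ c1 _]]; case: (s) c c1 => [c|v s' _ _].
    by rewrite big_ord0 => /eqP; rewrite eq_sym oner_eq0.
  by exists v; rewrite mem_head.
have [_ [_ [_ [_ _ _ _ gamma1]]]] := corner _ v0s.
have [g gE] : exists g : nat, gamma = g.+1%:Z.
  by exists `|gamma - 1|%N; lia.
(* With $d\ge 1$ this is $(\gamma-1)(d-1)$, and the hypothesis on [k] reads $Nn<k$. *)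
pose N := (g * d.-1)%N.
have kN : (N * n < k)%N.
  rewrite /N; move: kge; rewrite gE; case: (d) d_ge1 => // d' _ /=; lia.
have sx : dilate [set` s] k%:R x.
  rewrite xE; apply: dilateZ1 => //; by rewrite -sP in Py.
have n0 : (0 < n)%N by apply: leq_trans size_s; case: (s) v0s.
have [v vs xN] := heavy_vertex size_s kN sx.
have Acl z : dilate A 1 z -> M z -> A z.
  by move=> Az Mz; split=> //; rewrite -sP; apply: dilate_trans Az => u [+ _]; rewrite -sP.
have MxN : M (x - v *+ N).
  by apply: (latticeB M_lattice) => //; apply: (latticeMn M_lattice); apply: sM.
have AM : A `<=` M by move=> u [].
have [l [r [ld lk Mr Ar sr]]] :=
  peel M_lattice d_ge1 AM Acl MxN (dilate_sub sA xN).
have [b [f [h [bA fb fint [hE bounds] _]]]] := corner _ vs.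
have Mrv : M (r - v *+ l).
  by apply: (latticeB M_lattice) => //; apply: (latticeMn M_lattice); apply: sM.
(* On [P] each [f i] is at least its value at [v], and [r] has weight [l]. Being integral as well,
   these coordinates are natural numbers. *)
have f0 i : 0 <= f i (r - v *+ l).
  rewrite linearB/= linearMn subr_ge0 -mulr_natr.
  by apply: dilate_ge Ar => u [/bounds[_]].
have /choice[c cE] i : exists c : nat, f i (r - v *+ l) = c%:R.
  by apply/natrP; rewrite natrEint f0 fint.
(* From $h\le h(v)+\gamma$ on [P] the sum is at most $\gamma l=l+(\gamma-1)l$, and $l\le d-1$ bounds
   the last term by [N]. *)
have cle : (\sum_i c i <= l + N)%N.
  have : h (r - v *+ l) <= gamma%:~R * l%:R.
    rewrite linearB/= linearMn lerBlDr -(mulr_natr (h v)) -mulrDl addrC.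
    by apply: dilate_le Ar => u [/bounds[]].
  rewrite hE (eq_bigr _ (fun i _ => cE i)).
  rewrite -natr_sum gE -pmulrn -natrM ler_nat => /leq_trans; apply.
  by rewrite /N; move: ld; case: (d) => // d'; rewrite ltnS /= => ld; nia.
(* Of the $l+N$ copies of [v], $\sum_i c_i$ are joined to the [b i]; by [cle] the subtraction
   counting the rest is not truncated. *)
have rE : r + v *+ N = \sum_i (v + b i) *+ c i + v *+ (l + N - \sum_i c i).
  have -> : r = \sum_i b i *+ c i + v *+ l.
    rewrite -[r](subrK (v *+ l)); congr (_ + _); rewrite [LHS]fb.
    by apply: eq_bigr => i _; rewrite cE scaler_nat.
  rewrite [\sum_i _ *+ c i in RHS](eq_bigr _ (fun i _ => mulrnDl _ _ _)).
  by rewrite big_split/= sumrMnr -!addrA [RHS]addrCA; congr (_ + _); rewrite -!mulrnDr subnKC.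
have : nsum A ((k - N - l) + (\sum_i c i + (l + N - \sum_i c i)))
  (x - v *+ N - r + (\sum_i (v + b i) *+ c i + v *+ (l + N - \sum_i c i))).
  apply: nsumD => //; apply: nsumD; first by apply: nsum_sum => i; apply: bA.
  by apply: nsumMn; apply: sA.
rewrite -rE subnKC//.
have -> : (k - N - l + (l + N))%N = k.
  have := leq_trans (leq_pmulr N n0) (ltnW kN); lia.
by rewrite addrA subrK subrK.
Qed.
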